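(* Let $\mathbf{A}\in\mathbb{R}^{d\times d}$ be invertible, $\mathbf{b}\in\mathbb{R}^d$, and let a valid two-layer region graph be given for $\mathbf{A}$, with associated partition $F$ of the variables and associated block form $(\mathbf{A}_{ij})_{i,j\in F}$ of $\mathbf{A}$. Suppose $\det\mathbf{A}_{ii}\neq 0$ for all $i\in F$, and let $\left\|\widetilde{\mathbf{R}}\right\|$ be the matrix indexed by $F\times F$ with entries $\|\widetilde{\mathbf{R}}_{ij}\|$, where $\widetilde{\mathbf{R}}_{ij}=\mathbf{I}_{ij}-\mathbf{A}_{ii}^{-1}\mathbf{A}_{ij}$. If $\rho\left(\left\|\widetilde{\mathbf{R}}\right\|\right)<1$ for some operator norm $\|\cdot\|$, then the generalized two-layer GaBP algorithm (defined in the context) converges to the exact solution $\mathbf{x}=\mathbf{A}^{-1}\mathbf{b}$, i.e. for each large region $L$ the vectors $[\mathbf{x}]_L$ computed in the $n$-th sweep converge to $[\mathbf{A}^{-1}\mathbf{b}]_L$ as $n\to\infty$.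
   Context: $\mathbf{A}$ is not assumed symmetric. Let $\Gamma$ be the undirected graph on $\{1,\dots,d\}$ with an edge $\{i,j\}$, $i\ne j$, whenever $A_{ij}\ne 0$ or $A_{ji}\neq0$. A region is a connected subgraph of $\Gamma$, consisting of a nonempty set of vertices and all edges of $\Gamma$ between them; it is identified with its vertex set. A two-layer region graph is a directed bipartite graph whose vertices $\mathcal{R}$ are finitely many large regions $\{L_i\}$ and small regions $\{l_i\}$, with edges $(L,l)\in\mathcal{E}_{\mathcal{R}}$ directed from some large regions $L$ to small regions $l\subset L$. If $(L,l)\in\mathcal{E}_{\mathcal{R}}$ then $L$ is a parent of $l$ and $l$ a child of $L$; $P(l)$ is the set of parents of $l$, $C(L)$ the set of children of $L$. Counting numbers are $c_L=1$ for large regions and $c_l=1-|P(l)|$ for small regions. The region graph is valid if every vertex $v$ and every edge $e$ of $\Gamma$ is counted exactly once: $\sum_{r\in\mathcal{R},\,v\in r}c_r=\sum_{r\in\mathcal{R},\,e\in r}c_r=1$. Partition $F$: $F$ is the collection of the nonempty sets among all small regions $l_i$ and all sets $L_j\setminus\bigcup_{l\in C(L_j)}l$; it is assumed to be a partition of $\{1,\dots,d\}$. For $i,j\in F$, $\mathbf{A}_{ij}$ is the block of $\mathbf{A}$ with rows in $i$ and columns in $j$, and $\mathbf{I}_{ij}$ the corresponding block of the identity matrix. Operator norm: a vector norm is fixed on the space $\mathbb{R}^{|i|}$ of each block $i\in F$, and $\|\widetilde{\mathbf{R}}_{ij}\|$ is the induced norm of $\widetilde{\mathbf{R}}_{ij}$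 as a linear map from $\mathbb{R}^{|j|}$ to $\mathbb{R}^{|i|}$. $\rho$ is the spectral radius. Notation: for a set of indices $k$, $[\mathbf{M}]_k$ is the submatrix of $\mathbf{M}$ with rows and columns in $k$, and $[\mathbf{v}]_k$ the subvector of $\mathbf{v}$ with indices in $k$. For $k\subset L$ and a matrix $\mathbf{C}$ (vector $\mathbf{c}$) indexed by $k$, $]\mathbf{C}[_k$ ($]\mathbf{c}[_k$) is its extension by zeros to a matrix (vector) indexed by $L$. Generalized two-layer GaBP algorithm. Each edge $(L,l)\in\mathcal{E}_{\mathcal{R}}$ carries messages $\mathbf{m}_{Ll}\in\mathbb{R}^{|l|}$ and $\mathbf{\Lambda}_{Ll}\in\mathbb{R}^{|l|\times|l|}$, initialised at zero. Repeat sweeps (without stopping, for the purpose of convergence); in each sweep, for each large region $L$ in a fixed order, using current message values (in-place updates): 1. $\widetilde{\mathbf{b}}_0=[\mathbf{b}]_L+\sum_{l\in C(L)}\sum_{L'\in P(l)\setminus\{L\}}]\mathbf{m}_{L'l}[_l$ and $\widetilde{\mathbf{\Lambda}}_0=[\mathbf{A}]_L+\sum_{l\in C(L)}\sum_{L'\in P(l)\setminus\{L\}}]\mathbf{\Lambda}_{L'l}[_l$; 2. $[\mathbf{x}]_L\leftarrow\widetilde{\mathbf{\Lambda}}_0^{-1}\widetilde{\mathbf{b}}_0$; 3. for each $l\in C(L)$: $\mathbf{m}_{Ll}\leftarrow\big([\widetilde{\mathbf{\Lambda}}_0^{-1}]_l\big)^{-1}[\mathbf{x}]_l-[\mathbf{b}]_l-\sum_{L'\in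 P(l)\setminus\{L\}}\mathbf{m}_{L'l}$ and $\mathbf{\Lambda}_{Ll}\leftarrow\big([\widetilde{\mathbf{\Lambda}}_0^{-1}]_l\big)^{-1}-[\mathbf{A}]_l-\sum_{L'\in P(l)\setminus\{L\}}\mathbf{\Lambda}_{L'l}$, where in step 3 $[\mathbf{x}]_l$ is the restriction to $l$ of the vector $[\mathbf{x}]_L$ just computed for $L$. *)

(* Defs.v *)
From HB Require Import structures.
From mathcomp Require Import all_boot all_order all_algebra.
From mathcomp Require Import all_classical all_reals all_analysis.
From mathcomp Require Import complex.

Set Implicit Arguments.
Unset Strict Implicit.
Unset Printing Implicit Defensive.

Import Order.TTheory GRing.Theory Num.Theory.
Import numFieldNormedType.Exports.

Local Open Scope classical_set_scope.
Local Open Scope ring_scope.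

(* Indices are 'I_d; a vector indexed by k : {set 'I_d} is a 'cV_#|k| whose   *)
(* entry a : 'I_#|k| stands for the index enum_val a of k.                    *)

Section Submatrices.
Variables (R : realType) (d : nat).
Implicit Types (M : 'M[R]_d) (v : 'cV[R]_d) (i j k L : {set 'I_d}).

Definition block M i j : 'M[R]_(#|i|, #|j|) :=
  mxsub (@enum_val _ (mem i)) (@enum_val _ (mem j)) M.

Definition submat M k : 'M[R]_#|k| := block M k k.

Definition subvec v k : 'cV[R]_#|k| := rowsub (@enum_val _ (mem k)) v.

Definition idblock i j : 'M[R]_(#|i|, #|j|) := block 1%:M i j.

(* For k \subset L, multiplying by idblock k L on the left selects the        *)
(* entries with index in k, and by idblock L k puts them back at their places *)
(* in L, with zeros elsewhere (see the lemmas at the end of the section).     *)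
Definition restr_vec L k (c : 'cV[R]_#|L|) : 'cV[R]_#|k| := idblock k L *m c.

Definition restr_mx L k (C : 'M[R]_#|L|) : 'M[R]_#|k| :=
  idblock k L *m C *m idblock L k.

Definition ext_vec L k (c : 'cV[R]_#|k|) : 'cV[R]_#|L| := idblock L k *m c.

Definition ext_mx L k (C : 'M[R]_#|k|) : 'M[R]_#|L| :=
  idblock L k *m C *m idblock k L.

Lemma mul_idblockl k L n (B : 'M[R]_(#|L|, n)) (a : 'I_#|k|) (b : 'I_#|L|) c :
  enum_val a = enum_val b -> (idblock k L *m B) a c = B b c.
Proof.
move=> ab; rewrite mxE (bigD1 b) //= !mxE ab eqxx mul1r big1 ?addr0 // => b' nb.
rewrite !mxE ab (inj_eq enum_val_inj) eq_sym (negPf nb).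
by rewrite mul0r.
Qed.

Lemma mul_idblockl0 k L n (B : 'M[R]_(#|L|, n)) (a : 'I_#|k|) c :
  enum_val a \notin L -> (idblock k L *m B) a c = 0.
Proof.
move=> aL; rewrite mxE big1 // => b _; rewrite !mxE.
case: eqP => [ab|_]; last by rewrite mul0r.
by move: aL; rewrite ab enum_valP.
Qed.

Lemma trmx_idblock k L : (idblock k L)^T = idblock L k.
Proof. by apply/matrixP => a b; rewrite !mxE eq_sym. Qed.

Lemma mul_idblockr k L n (B : 'M[R]_(n, #|L|)) (a : 'I_#|k|) (b : 'I_#|L|) c :
  enum_val a = enum_val b -> (B *m idblock L k) c a = B c b.
Proof.
move=> ab; have := mul_idblockl (B^T) c ab.
by rewrite -[idblock k L]trmx_idblock -trmx_mul !mxE.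
Qed.

Lemma mul_idblockr0 k L n (B : 'M[R]_(n, #|L|)) (a : 'I_#|k|) c :
  enum_val a \notin L -> (B *m idblock L k) c a = 0.
Proof.
move=> aL; have := mul_idblockl0 (B^T) c aL.
by rewrite -[idblock k L]trmx_idblock -trmx_mul !mxE.
Qed.

Lemma restr_vecE L k (c : 'cV[R]_#|L|) (a : 'I_#|k|) (b : 'I_#|L|) :
  enum_val a = enum_val b -> restr_vec k c a 0 = c b 0.
Proof. exact: mul_idblockl. Qed.

Lemma restr_mxE L k (C : 'M[R]_#|L|) (a a' : 'I_#|k|) (b b' : 'I_#|L|) :
  enum_val a = enum_val b -> enum_val a' = enum_val b' ->
  restr_mx k C a a' = C b b'.
Proof.
by move=> ab ab'; rewrite /restr_mx (mul_idblockr _ _ ab') (mul_idblockl _ _ ab).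
Qed.

Lemma ext_vecE L k (c : 'cV[R]_#|k|) (a : 'I_#|k|) (b : 'I_#|L|) :
  enum_val b = enum_val a -> ext_vec L c b 0 = c a 0.
Proof. exact: mul_idblockl. Qed.

Lemma ext_vec0 L k (c : 'cV[R]_#|k|) (b : 'I_#|L|) :
  enum_val b \notin k -> ext_vec L c b 0 = 0.
Proof. exact: mul_idblockl0. Qed.

Lemma ext_mxE L k (C : 'M[R]_#|k|) (a a' : 'I_#|k|) (b b' : 'I_#|L|) :
  enum_val b = enum_val a -> enum_val b' = enum_val a' ->
  ext_mx L C b b' = C a a'.
Proof.
by move=> ab ab'; rewrite /ext_mx (mul_idblockr _ _ ab') (mul_idblockl _ _ ab).
Qed.

Lemma ext_mx0 L k (C : 'M[R]_#|k|) (b b' : 'I_#|L|) :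
  (enum_val b \notin k) || (enum_val b' \notin k) -> ext_mx L C b b' = 0.
Proof.
case/orP => nk; last exact: mul_idblockr0.
by rewrite /ext_mx -mulmxA; apply: mul_idblockl0.
Qed.

End Submatrices.

Arguments idblock {R d} i j.

Section RegionGraphs.
Variables (R : realType) (d : nat).

Definition adj (A : 'M[R]_d) : rel 'I_d :=
  fun u v => (u != v) && ((A u v != 0) || (A v u != 0)).

Definition region (A : 'M[R]_d) (r : {set 'I_d}) : Prop :=
  r != finset.set0 /\
  {in r &, forall u v,
     connect [rel x y | [&& x \in r, y \in r & adj A x y]] u v}.

(* Since a region is identified with its vertex set, there are no repeated    *)
(* large (or small) regions. The vertices of the region graph form the        *)
(* disjoint union of large and small: a set may occur once in each role.      *)
Record region_graph : Type := RegionGraph {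
  large : {set {set 'I_d}};
  small : {set {set 'I_d}};
  redges : {set {set 'I_d} * {set 'I_d}} }.

Implicit Types (G : region_graph) (L l : {set 'I_d}).

Definition parents G l : {set {set 'I_d}} :=
  [set L : {set 'I_d} | (L, l) \in redges G]%SET.

Definition children G L : {set {set 'I_d}} :=
  [set l : {set 'I_d} | (L, l) \in redges G]%SET.

Definition two_layer (A : 'M[R]_d) G : Prop :=
  [/\ {in large G, forall L, region A L},
      {in small G, forall l, region A l} &
      forall L l, (L, l) \in redges G ->
        [/\ L \in large G, l \in small G & l \subset L]].

Definition cnum_large (L : {set 'I_d}) : int := 1.

Definition cnum_small G l : int := 1 - #|parents G l|%:Z.

Definition total_count G (P : pred {set 'I_d}) : int :=
  \sum_(L in large G | P L) cnum_large L +
  \sum_(l in small G | P l) cnum_small G l.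

Definition valid (A : 'M[R]_d) G : Prop :=
  (forall v : 'I_d, total_count G (fun r => v \in r) = 1) /\
  (forall u v : 'I_d, adj A u v ->
     total_count G (fun r => (u \in r) && (v \in r)) = 1).

Definition Fpart G : {set {set 'I_d}} :=
  ((small G :|: [set (L :\: \bigcup_(l in children G L) l)%SET
                   | L in large G]) :\ finset.set0)%SET.

End RegionGraphs.

Arguments RegionGraph {d}.

Section Norms.
Variable R : realType.

Record vector_norm n (N : 'cV[R]_n -> R) : Prop := VectorNorm {
  vnorm_triangle : forall x y, N (x + y) <= N x + N y;
  vnormZ : forall (a : R) x, N (a *: x) = `|a| * N x;
  vnorm_eq0 : forall x, N x = 0 -> x = 0 }.

Definition opnorm m n (Nm : 'cV[R]_m -> R) (Nn : 'cV[R]_n -> R)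
    (M : 'M[R]_(m, n)) : R :=
  sup [set Nm (M *m x) | x in [set x | Nn x <= 1]].

(* Complex eigenvalues count; ComplexField.normc is the modulus, with values  *)
(* in R.                                                                      *)
Definition spectral_radius n (M : 'M[R]_n) : R :=
  sup [set ComplexField.Normc.normc z
         | z in [set z : R[i] | eigenvalue (map_mx (real_complex R) M) z]].

Variable d : nat.

Definition Rtilde (A : 'M[R]_d) (i j : {set 'I_d}) : 'M[R]_(#|i|, #|j|) :=
  idblock i j - invmx (block A i i) *m block A i j.

Definition normRtilde (A : 'M[R]_d) (F : {set {set 'I_d}})
    (N : forall k : {set 'I_d}, 'cV[R]_#|k| -> R) : 'M[R]_#|F| :=
  \matrix_(p < #|F|, q < #|F|)
    let i := enum_val p in let j := enum_val q in
    opnorm (N i) (N j) (Rtilde A i j).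

End Norms.

Section GaBP.
Variables (R : realType) (d : nat).
Variables (A : 'M[R]_d) (b : 'cV[R]_d) (G : region_graph d).

Record state : Type := State {
  xval : forall L : {set 'I_d}, 'cV[R]_#|L|;
  msg : forall L l : {set 'I_d}, 'cV[R]_#|l|;
  msgLam : forall L l : {set 'I_d}, 'M[R]_#|l| }.

(* The initial xval is irrelevant: it is overwritten before being read.       *)
Definition init_state : state :=
  State (fun _ => 0) (fun _ _ => 0) (fun _ _ => 0).

Implicit Types (s : state) (L l : {set 'I_d}).

Definition in_m s L l : 'cV[R]_#|l| :=
  \sum_(L' in (parents G l :\ L)%SET) msg s L' l.

Definition in_Lam s L l : 'M[R]_#|l| :=
  \sum_(L' in (parents G l :\ L)%SET) msgLam s L' l.

Definition b0 s L : 'cV[R]_#|L| :=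
  subvec b L + \sum_(l in children G L)
    \sum_(L' in (parents G l :\ L)%SET) ext_vec L (msg s L' l).

Definition Lam0 s L : 'M[R]_#|L| :=
  submat A L + \sum_(l in children G L)
    \sum_(L' in (parents G l :\ L)%SET) ext_mx L (msgLam s L' l).

Definition new_x s L : 'cV[R]_#|L| := invmx (Lam0 s L) *m b0 s L.

Definition new_m s L l : 'cV[R]_#|l| :=
  invmx (restr_mx l (invmx (Lam0 s L))) *m restr_vec l (new_x s L)
  - subvec b l - in_m s L l.

Definition new_Lam s L l : 'M[R]_#|l| :=
  invmx (restr_mx l (invmx (Lam0 s L))) - submat A l - in_Lam s L l.

(* new_m s L l and new_Lam s L l do not read the messages sent by L, so the   *)
(* messages from L to its children can be replaced simultaneously.            *)
Definition update s L : state :=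
  State
    (fun K => if K == L then new_x s K else xval s K)
    (fun K l => if (K == L) && (l \in children G K)
                then new_m s K l else msg s K l)
    (fun K l => if (K == L) && (l \in children G K)
                then new_Lam s K l else msgLam s K l).

(* invmx is total; this says that the inverses used by update s L exist.      *)
Definition update_defined s L : Prop :=
  Lam0 s L \in unitmx /\
  {in children G L, forall l, restr_mx l (invmx (Lam0 s L)) \in unitmx}.

Definition sweep (order : seq {set 'I_d}) s : state := foldl update s order.

Definition gabp (order : seq {set 'I_d}) (n : nat) : state :=
  iter n (sweep order) init_state.

Definition gabp_defined (order : seq {set 'I_d}) : Prop :=
  forall (n : nat) pre L post, order = pre ++ L :: post ->
    update_defined (sweep pre (gabp order n)) L.

End GaBP.

(* Main.v *)
Require Import Defs.
From mathcomp Require Import all_boot all_order all_algebra.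
From mathcomp Require Import all_classical all_reals all_analysis.
From mathcomp Require Import complex ring lra.

(** Let xs be the exact solution.  Since the nonnegative matrix of block norms
    has spectral radius less than 1, there are positive weights w on the blocks
    and th < 1 with sum_k |R_jk| w_k <= th w_j for all j
    (contraction_weights).  Validity of the region graph means that two coupled
    blocks lie together in exactly one large region (edge_large), so that this
    row sum splits into budgets, one for every large region around j.

    The messages (m, Lam) from L to l are meant to replace the coupling of l to
    the other blocks of L; their defect is
      e = m - Lam xs_l + sum_k A_lk xs_k   (k in L, k != l).
    The incoming defects are exactly the residual of xs in the local system of a
    large region (residual_row).  Hence the new solution in L differs from xs by
    the local solution whose right-hand side is made of incoming defects, and the
    new defect is a linear function of the incoming ones, whose coefficients
    depend on the incoming matrices Lam (new_LamE, new_defectE).  Convergence of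
    the matrices Lam is therefore not required, only a bound on them that makes
    this linear map a contraction.

    The bound is the invariant good: |Lam| w_l + |e| / ep is at most the budget
    of l in L (norms are taken after multiplication by the inverse diagonal
    block).  If it holds for all incoming messages with ep, then it holds for the
    outgoing ones with th * ep (new_good), by a maximum principle in the scalar
    weights (comparison_principle); the same principle shows that the matrices to
    be inverted are invertible (Lam0_unit, restr_unit).  So n sweeps give the
    invariant with th ^ n * ep, and the error of x is at most a constant times
    th ^ n (sweep_good, gabp_cvg). *)

Import Order.TTheory GRing.Theory Num.Theory.
Import numFieldNormedType.Exports.
Local Open Scope classical_set_scope.
Local Open Scope ring_scope.

Set Implicit Arguments.
Unset Strict Implicit.

(** * Vector norms and operator norms *)

Section VectorNorms.
Variable R : realType.

Section OneNorm.
Variables (n : nat) (N : 'cV[R]_n -> R).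
Hypothesis hN : vector_norm N.

Lemma vnorm0 : N 0 = 0.
Proof. by rewrite -(scale0r (0 : 'cV[R]_n)) (vnormZ hN) normr0 mul0r. Qed.

Lemma vnormN x : N (- x) = N x.
Proof. by rewrite -scaleN1r (vnormZ hN) normrN1 mul1r. Qed.

Lemma vnorm_ge0 x : 0 <= N x.
Proof.
have := vnorm_triangle hN x (- x).
by rewrite subrr vnorm0 vnormN; lra.
Qed.

Lemma vnorm_sum I (r : seq I) (P : pred I) (F : I -> 'cV[R]_n) :
  N (\sum_(i <- r | P i) F i) <= \sum_(i <- r | P i) N (F i).
Proof.
elim/big_ind2: _ => [|x a y c xa yc|//]; first by rewrite vnorm0.
exact: le_trans (vnorm_triangle hN _ _) (lerD xa yc).
Qed.

Lemma vnorm_le_coord (x : 'cV[R]_n) (M : R) :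
  (forall a, `|x a 0| <= M) -> N x <= M * \sum_a N (delta_mx a 0).
Proof.
move=> xM; rewrite [x in N x]matrix_sum_delta; apply: le_trans (vnorm_sum _ _ _) _.
rewrite mulr_sumr; apply: ler_sum => a _; rewrite big_ord1 (vnormZ hN).
by rewrite ler_wpM2r ?vnorm_ge0.
Qed.

Lemma vnorm_lipschitz (x y : 'cV[R]_n) : `|N x - N y| <= N (x - y).
Proof.
have h u v : N u - N v <= N (u - v).
  by rewrite lerBlDr; apply: le_trans (vnorm_triangle hN _ _); rewrite subrK.
rewrite ler_norml h andbT.
by have := h y x; rewrite -[N (y - x)]vnormN opprB; have := h x y; lra.
Qed.

Lemma coord_le_norm (x : 'rV[R]_n) a : `|x 0 a| <= `|x|.
Proof.
have := @mx_normrE _ _ _ x; rewrite [`|x|]/Num.norm /= => ->.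
by apply/bigmax_geP; right => /=; exists (0, a).
Qed.

Lemma vnorm_continuous : continuous (fun x : 'rV[R]_n => N x^T).
Proof.
move=> x; set K := \sum_a N (delta_mx a 0).
have K0 : 0 <= K by apply: sumr_ge0 => a _; exact: vnorm_ge0.
move=> V /nbhs_ballP[e /= e0 eV]; apply/nbhs_ballP.
exists (e / (K + 1)); first by rewrite /= divr_gt0 // ltr_wpDl.
move=> y; rewrite mx_norm_ball /ball_ /= => xy; apply: eV.
apply: le_lt_trans (vnorm_lipschitz _ _) _.
rewrite -raddfB; apply: le_lt_trans (@vnorm_le_coord _ `|x - y| _) _.
  by move=> a; rewrite mxE; exact: coord_le_norm.
apply: (@le_lt_trans _ _ (`|x - y| * (K + 1))); last by rewrite -ltr_pdivlMr ?ltr_wpDl.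
by rewrite mulrDr mulr1 lerDl.
Qed.

(** All norms on a finite-dimensional space are equivalent: N is continuous, so
    it has a positive minimum on the compact unit sphere of the sup norm. *)
Lemma vnorm_coord :
  exists2 C : R, 0 < C & forall (x : 'cV[R]_n) a, `|x a 0| <= C * N x.
Proof.
pose S := [set x : 'rV[R]_n | `|x| = 1].
have nS (x : 'rV[R]_n) : x != 0 -> S (`|x|^-1 *: x).
  move=> x0; rewrite /S /= normrZ normfV normr_id mulVf //.
  by rewrite normr_eq0.
have [S0|Sn] := eqVneq S set0.
  exists 1 => // x a.
  have -> : x = 0.
    apply: contrapT => /eqP x0; have : S (`|x^T|^-1 *: x^T).
      by apply: nS; rewrite trmx_eq0.
    by rewrite S0.
  by rewrite mxE normr0 vnorm0 mulr0.
have cS : compact S.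
  apply: bounded_closed_compact.
    exists 1; split; first exact: num_real.
    by move=> M M1 x /= ->; exact: ltW.
  rewrite (_ : S = (fun x : 'rV[R]_n => `|x|) @^-1` [set 1]) //.
  by apply: preimage_closed; [move=> x _; exact: norm_continuous | exact: closed_eq].
have /set0P Sn' := Sn.
have [x0 x0S x0min] := compact_EVT_min Sn' cS (continuous_subspaceT vnorm_continuous).
have c0 : 0 < N x0^T.
  rewrite lt_neqAle vnorm_ge0 andbT eq_sym; apply/eqP => /(vnorm_eq0 hN) h.
  move: x0S; rewrite inE /S /= -[x0]trmxK h trmx0 normr0 => /eqP.
  by rewrite eq_sym oner_eq0.
exists (N x0^T)^-1; first by rewrite invr_gt0.
move=> x a; rewrite -ler_pdivrMl ?invr_gt0 // invrK.
have [->|xn0] := eqVneq x 0; first by rewrite mxE normr0 mulr0 vnorm0.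
have xT0 : x^T != 0 by rewrite trmx_eq0.
have := x0min _ (mem_set (nS _ xT0)).
rewrite linearZ /= trmxK (vnormZ hN) normfV normr_id.
rewrite ler_pdivlMl ?normr_gt0 //; apply: le_trans.
rewrite mulrC ler_wpM2r ?vnorm_ge0 //.
by have := coord_le_norm x^T a; rewrite mxE.
Qed.

End OneNorm.

Section OperatorNorm.
Variables (m n : nat) (Nm : 'cV[R]_m -> R) (Nn : 'cV[R]_n -> R).
Hypotheses (hm : vector_norm Nm) (hn : vector_norm Nn).
Implicit Type M : 'M[R]_(m, n).

(** The supremum defining the operator norm is over a bounded set, because the
    coordinates are bounded on the unit ball of the norm Nn. *)
Lemma opnorm_has_sup M :
  has_sup [set Nm (M *m x) | x in [set x | Nn x <= 1]].
Proof.
split; first by exists (Nm (M *m 0)), 0 => //=; rewrite vnorm0.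
have [C C0 hC] := vnorm_coord hn.
exists (\sum_c C * Nm (col c M)) => _ [x /= x1 <-].
have -> : M *m x = \sum_c x c 0 *: col c M.
  apply/matrixP => i j; rewrite !mxE summxE ord1; apply: eq_bigr => c _.
  by rewrite !mxE mulrC.
apply: le_trans (vnorm_sum hm _ _ _) _.
apply: ler_sum => c _; rewrite (vnormZ hm) ler_wpM2r ?vnorm_ge0 //.
by apply: le_trans (hC _ _) _; rewrite ler_piMr // ltW.
Qed.

Lemma opnorm_ge0 M : 0 <= opnorm Nm Nn M.
Proof.
apply: (ub_le_sup (opnorm_has_sup M).2).
by exists 0 => /=; rewrite ?mulmx0 vnorm0.
Qed.

Lemma opnormP M x : Nm (M *m x) <= opnorm Nm Nn M * Nn x.
Proof.
have [->|x0] := eqVneq x 0; first by rewrite mulmx0 !vnorm0 // mulr0.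
have nx : 0 < Nn x.
  rewrite lt_neqAle vnorm_ge0 // andbT eq_sym.
  by apply/eqP => /(vnorm_eq0 hn)/eqP; rewrite (negPf x0).
rewrite -ler_pdivrMr // mulrC.
apply: (ub_le_sup (opnorm_has_sup M).2).
exists ((Nn x)^-1 *: x) => /=.
  by rewrite (vnormZ hn) gtr0_norm ?invr_gt0 // mulVf // gt_eqF.
by rewrite -scalemxAr (vnormZ hm) gtr0_norm ?invr_gt0.
Qed.

Lemma opnorm0 : opnorm Nm Nn 0 = 0.
Proof.
apply/eqP; rewrite eq_le opnorm_ge0 andbT.
apply: ge_sup; first exact: (opnorm_has_sup 0).1.
by move=> _ [x _ <-]; rewrite mul0mx vnorm0.
Qed.

End OperatorNorm.
End VectorNorms.

(** * Weights from the spectral radius *)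

Section ContractionWeights.
Variables (R : realType) (n : nat).
Variable T : 'M[R]_n.

(** The moduli of the complex eigenvalues are bounded (they are the roots of the
    characteristic polynomial), so their supremum is an upper bound. *)
Lemma eigenvalue_le_spectral_radius (t : R) :
  0 <= t -> eigenvalue T t -> t <= spectral_radius T.
Proof.
move=> t0 et; apply: ub_le_sup; last first.
  exists (real_complex R t).
    by rewrite /= (eigenvalue_map (real_complex R)).
  by rewrite /= expr0n /= addr0 sqrtr_sqr ger0_norm.
set M := map_mx _ T.
have [r Er] := closed_field_poly_normal (char_poly M).
exists (\sum_(z <- r) ComplexField.Normc.normc z) => _ [z /= ez <-].
have zr : z \in r.
  move: ez; rewrite eigenvalue_root_char Er (monicP (char_poly_monic _)) scale1r.
  by rewrite root_prod_XsubC.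
have nn (x : R[i]) : 0 <= ComplexField.Normc.normc x.
  by case: x => a b; rewrite /= sqrtr_ge0.
rewrite (perm_big _ (perm_to_rem zr)) big_cons lerDl /=.
exact: sumr_ge0.
Qed.

Hypothesis T_ge0 : forall i j, 0 <= T i j.
Hypothesis rho_lt1 : spectral_radius T < 1.

Let detI (s : R) := \det (1%:M - s *: T).
(** adjsum i s is detI s times the i-th entry of (1 - s T)^-1 (1, ..., 1)^T. *)
Let adjsum i (s : R) := \sum_j (\adj (1%:M - s *: T)) i j.

Lemma detI_neq0 s : 0 <= s <= 1 -> detI s != 0.
Proof.
move=> /andP[s0 s1]; have [->|sn0] := eqVneq s 0.
  by rewrite /detI scale0r subr0 det1 oner_eq0.
have spos : 0 < s by rewrite lt_neqAle eq_sym sn0.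
apply/negP => /det0P[v v0]; rewrite mulmxBr mulmx1 => /eqP.
rewrite subr_eq0 -scalemxAr => /eqP vE.
have : eigenvalue T s^-1.
  apply/eigenvalueP; exists v => //.
  by rewrite [in RHS]vE scalerA mulVf ?scale1r.
move/eigenvalue_le_spectral_radius; rewrite invr_ge0 => /(_ s0) h.
have := le_lt_trans h rho_lt1; rewrite invf_lt1 //.
by rewrite ltNge s1.
Qed.

Let pencil : 'M[{poly R}]_n := 1%:M - 'X *: map_mx polyC T.

Lemma eval_pencil s : map_mx (horner_eval s) pencil = 1%:M - s *: T.
Proof.
apply/matrixP => i j; rewrite !mxE /horner_eval hornerD hornerN hornerM.
by rewrite hornerX hornerMn !hornerC.
Qed.

Lemma detI_horner s : detI s = (\det pencil).[s].
Proof. by rewrite /detI -eval_pencil det_map_mx. Qed.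

Lemma adjsum_horner i s : adjsum i s = (\sum_j \adj pencil i j).[s].
Proof.
rewrite /adjsum -eval_pencil horner_sum; apply: eq_bigr => j _.
by rewrite -map_mx_adj mxE.
Qed.

Lemma detI_gt0 s : 0 <= s <= 1 -> 0 < detI s.
Proof.
move=> /andP[s0 s1]; rewrite ltNge; apply/negP => Ds.
have [|x /andP[x0 xs] /rootP] := @poly_ivt R (- \det pencil) 0 s s0.
  rewrite !hornerN -!detI_horner oppr_ge0 oppr_le0 Ds andbT.
  by rewrite /detI scale0r subr0 det1 ler01.
move/eqP; rewrite hornerN oppr_eq0 -detI_horner => /eqP Dx.
have : detI x != 0 by rewrite detI_neq0 // x0 (le_trans xs).
by rewrite Dx eqxx.
Qed.

(** The identity (1 - s T) adj(1 - s T) = det(1 - s T), applied to the vector of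
    ones. *)
Lemma adjsum_eq i s : adjsum i s = s * (\sum_k T i k * adjsum k s) + detI s.
Proof.
have := mul_mx_adj (1%:M - s *: T); rewrite -/(detI s) mulmxBl mul1mx.
move=> /(congr1 (fun M : 'M[R]_n => \sum_j M i j)).
have -> : \sum_j (detI s)%:M i j = detI s.
  rewrite (bigD1 i) //= mxE eqxx mulr1n big1 ?addr0 // => j /negPf ji.
  by rewrite mxE eq_sym ji.
move=> <-; rewrite addrC.
rewrite [X in X + _](_ : _ = adjsum i s - s * \sum_k T i k * adjsum k s) ?subrK //.
have -> : s * \sum_k T i k * adjsum k s
       = \sum_j \sum_k s * T i k * (\adj (1%:M - s *: T)) k j.
  rewrite mulr_sumr exchange_big /=; apply: eq_bigr => k _.
  by rewrite /adjsum mulrA mulr_sumr.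
rewrite -sumrB; apply: eq_bigr => j _.
rewrite [LHS]mxE; congr (_ + _); rewrite 2!mxE; congr (- _).
by apply: eq_bigr => k _; rewrite !mxE.
Qed.

(** As s runs from 0 to 1 the least entry m(s) of the vector adjsum _ s is
    continuous and m(0) = 1.  It cannot vanish: at such an s all entries are
    nonnegative, and adjsum_eq bounds each of them below by detI s > 0. *)
Lemma adjsum1_gt0 i : 0 < adjsum i 1.
Proof.
pose m s := \big[Order.min/1]_i adjsum i s.
have cm : continuous m.
  rewrite /m; elim: (index_enum _) => [|k r IH].
    under eq_fun do rewrite big_nil; exact: cst_continuous.
  under eq_fun do rewrite big_cons.
  move=> x; apply: (@continuous_min R R (adjsum k)); last exact: IH.
  have -> : adjsum k = horner (\sum_j \adj pencil k j) by apply/funext => s; exact: adjsum_horner.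
  exact: continuous_horner.
suff : 0 < m 1 by move/lt_le_trans; apply; exact: bigmin_le.
have m0 : m 0 = 1.
  apply: bigmin_eq_id => k _.
  by rewrite adjsum_eq mul0r add0r /detI scale0r subr0 det1.
rewrite ltNge; apply/negP => m1.
have [|s] := @IVT R m 0 1 0 ler01 (continuous_subspaceT cm).
  by rewrite m0 ge_min m1 orbT /= le_max ler01.
rewrite in_itv /= => sI ms.
have q0 k : 0 <= adjsum k s by rewrite -ms bigmin_le.
have /bigmin_leP[|[k _]] : m s <= 0 by rewrite ms.
  by rewrite leNgt ltr01.
rewrite adjsum_eq leNgt => /negP; apply; rewrite ltr_wpDl ?detI_gt0 //.
case/andP: sI => s0 _; rewrite mulr_ge0 // sumr_ge0 // => j _.
by rewrite mulr_ge0.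
Qed.

(** The vector w = adjsum _ 1 solves w - T w = detI 1 in every coordinate, hence
    T w < w; th is chosen so that (1 - th) w i <= detI 1 for all i. *)
Lemma contraction_weights :
  exists (w : 'I_n -> R) (th : R),
    [/\ 0 < th < 1, forall i, 0 < w i &
        forall i, \sum_k T i k * w k <= th * w i].
Proof.
exists (fun i => adjsum i 1); set W := \sum_i adjsum i 1.
have D1 : 0 < detI 1 by apply: detI_gt0; rewrite ler01 lexx.
have W0 : 0 <= W by apply: sumr_ge0 => i _; rewrite ltW ?adjsum1_gt0.
set de := detI 1 / (2 * detI 1 + W).
have den0 : 0 < 2 * detI 1 + W by rewrite ltr_wpDr // mulr_gt0.
have de0 : 0 < de by rewrite divr_gt0.
have de1 : de < 1 by rewrite ltr_pdivrMr // mul1r; lra.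
exists (1 - de); split.
- by apply/andP; split; lra.
- exact: adjsum1_gt0.
move=> i; have := adjsum_eq i 1; rewrite mul1r => qE.
suff : de * adjsum i 1 <= detI 1 by lra.
rewrite mulrAC ler_pdivrMr // ler_pM2l //.
have : adjsum i 1 <= W.
  by rewrite /W (bigD1 i) //= lerDl sumr_ge0 // => j _; rewrite ltW ?adjsum1_gt0.
lra.
Qed.

End ContractionWeights.

(** * Comparison in the weights *)

Section Comparison.

(** Look at the index j where s j / w j is largest.  If this maximum mu exceeded
    th * ep, row j of the inequalities would give
    mu * ((1 - th) * w j + D) <= ep * D with D = be j - la j <= th * w j,
    and D <= th * ((1 - th) * w j + D) then yields mu <= th * ep.  The term
    la j * s j is not small: the gain th comes from the forcing term
    being only what la j leaves of be j. *)
Lemma comparison_principle (R : realFieldType) (T : finType) (J : pred T)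
    (t : T -> T -> R) (w s g be la : T -> R) (th ep c : R) :
  0 < th < 1 -> 0 <= ep -> c <= th * ep ->
  (forall j, J j -> 0 < w j) ->
  (forall j k, J j -> J k -> 0 <= t j k) ->
  (forall j, J j -> 0 <= g j) ->
  (forall j, J j -> 0 <= la j <= be j) ->
  (forall j, J j ->
    \sum_(k | J k && (k != j)) t j k * w k + g j + be j <= th * w j) ->
  (forall j, J j ->
    w j * s j <= w j * (\sum_(k | J k && (k != j)) t j k * s k + g j * c)
                 + la j * s j + w j * (ep * (be j - la j))) ->
  forall j, J j -> s j <= th * ep * w j.
Proof.
move=> /andP[th0 th1] ep0 cle w0 t0 g0 labe hw hs j Jj.
case: (@arg_maxP _ _ _ j J (fun i => s i / w i) Jj) => i Ji imax.
set mu := s i / w i in imax.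
have smu k : J k -> s k <= mu * w k.
  by move=> Jk; rewrite -ler_pdivrMr ?w0 //; apply: imax.
suff mule : mu <= th * ep.
  by apply: le_trans (smu _ Jj) _; rewrite ler_pM2r ?w0.
rewrite leNgt; apply/negP => mugt.
have wi0 := w0 _ Ji; have /andP[la0 labei] := labe _ Ji; have gi0 := g0 _ Ji.
have si : s i = mu * w i by rewrite /mu divfK // gt_eqF.
have mu0 : 0 < mu by apply: le_lt_trans mugt; rewrite mulr_ge0 // ltW.
set S := \sum_(k | J k && (k != i)) t i k * w k.
have S0 : 0 <= S.
  by apply: sumr_ge0 => k /andP[Jk _]; rewrite mulr_ge0 ?t0 // ltW ?w0.
have Sle : \sum_(k | J k && (k != i)) t i k * s k <= mu * S.
  rewrite /S mulr_sumr; apply: ler_sum => k /andP[Jk _].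
  by rewrite mulrCA ler_wpM2l ?t0 ?smu.
have := hs _ Ji; have := hw _ Ji; rewrite -/S si => h1 h2.
have h3 : mu * w i <= mu * S + g i * c + la i * mu + ep * (be i - la i).
  rewrite -(ler_pM2l wi0); apply: le_trans h2 _.
  have : w i * (\sum_(k | J k && (k != i)) t i k * s k) <= w i * (mu * S).
    by rewrite ler_pM2l.
  by rewrite !mulrDr; lra.
have h4 : g i * c <= g i * mu by rewrite ler_wpM2l // (le_trans cle) // ltW.
have h5 : mu * (S + g i + be i) <= mu * (th * w i) by rewrite ler_pM2l.
have h6 : mu * ((1 - th) * w i + (be i - la i)) <= ep * (be i - la i).
  by move: h3 h4 h5; rewrite !(mulrDr, mulrBr, mulrDl, mulrBl); lra.
have h7 : (1 - th) * (be i - la i) <= (1 - th) * (th * w i).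
  by rewrite ler_pM2l ?subr_gt0 //; lra.
have h8 : ep * (be i - la i) <= (th * ep) * ((1 - th) * w i + (be i - la i)).
  rewrite (mulrC th) -mulrA ler_wpM2l //; move: h7.
  by rewrite !(mulrDr, mulrBr, mulrDl, mulrBl); lra.
have pos : 0 < (1 - th) * w i + (be i - la i).
  by rewrite ltr_wpDr ?mulr_gt0 ?subr_gt0 ?subr_ge0.
by have := le_trans h6 h8; rewrite ler_pM2r // leNgt mugt.
Qed.

End Comparison.

(** * Blocks of matrices and vectors *)

Section Blocks.
Variables (R : realType) (d : nat).
Implicit Types (A : 'M[R]_d) (x : 'cV[R]_d) (i j k L : {set 'I_d}).

Lemma idblock_block A i L k : i \subset L ->
  idblock i L *m block A L k = block A i k.
Proof.
move=> iL; apply/matrixP => a c.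
have aL : enum_val a \in L by apply: (fintype.subsetP iL); exact: enum_valP.
have E : enum_val a = enum_val (enum_rank_in aL (enum_val a)).
  by rewrite enum_rankK_in.
by rewrite (mul_idblockl _ _ E) !mxE -E.
Qed.

Lemma idblock_subvec x i L : i \subset L ->
  idblock i L *m subvec x L = subvec x i.
Proof.
move=> iL; apply/matrixP => a c.
have aL : enum_val a \in L by apply: (fintype.subsetP iL); exact: enum_valP.
have E : enum_val a = enum_val (enum_rank_in aL (enum_val a)).
  by rewrite enum_rankK_in.
by rewrite (mul_idblockl _ _ E) !mxE -E.
Qed.

Lemma idblock_mul i L k : i \subset L ->
  idblock i L *m idblock L k = idblock i k :> 'M[R]_(_, _).
Proof. exact: idblock_block. Qed.

Lemma idblock_refl i : idblock i i = 1%:M :> 'M[R]_(_, _).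
Proof. by apply/matrixP => a c; rewrite !mxE (inj_eq enum_val_inj). Qed.

Lemma idblock_disjoint i k : [disjoint i & k]%B ->
  idblock i k = 0 :> 'M[R]_(_, _).
Proof.
move=> dis; apply/matrixP => a c; rewrite !mxE.
case: eqP => // E; have := disjointFr dis (enum_valP a).
by rewrite E enum_valP.
Qed.

Variable F : {set {set 'I_d}}.
Hypothesis F_partition : finset.partition F [set: 'I_d]%SET.

Lemma sum_partition (f : 'I_d -> R) :
  \sum_(k in F) \sum_(c < #|k|) f (enum_val c) = \sum_c f c.
Proof.
have /and3P[/eqP covF trivF _] := F_partition.
under eq_bigr => k _ do rewrite -(big_enum_val (A := mem k) f).
rewrite -(finset.big_trivIset _ trivF) covF.
by apply: eq_bigl => c; rewrite inE.
Qed.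

(** For A = 1 this is the decomposition of a vector indexed by L into its blocks,
    for general A the block form of the rows i of A. *)
Lemma block_sum A i L :
  block A i L = \sum_(k in F) block A i k *m idblock k L.
Proof.
apply/matrixP => a c; rewrite summxE.
pose f v := A (enum_val a) v * (v == enum_val c)%:R.
transitivity (\sum_v f v).
  rewrite (bigD1 (enum_val c)) //= big1 ?addr0 /f ?eqxx ?mulr1 ?mxE //.
  by move=> v /negPf ->; rewrite mulr0.
rewrite -sum_partition; apply: eq_bigr => k _.
by rewrite mxE; apply: eq_bigr => e _; rewrite !mxE.
Qed.

Lemma subvec_mulmx A x i :
  subvec (A *m x) i = \sum_(k in F) block A i k *m subvec x k.
Proof.
apply/matrixP => a c; rewrite summxE !mxE ord1.
rewrite -sum_partition; apply: eq_bigr => k _.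
by rewrite !mxE; apply: eq_bigr => e _; rewrite !mxE.
Qed.

End Blocks.

(** * Regions and blocks *)

Section Combinatorics.
Variables (R : realType) (d : nat) (A : 'M[R]_d) (G : region_graph d).
Hypothesis G_two_layer : two_layer A G.
Hypothesis G_valid : valid A G.
Hypothesis F_partition : finset.partition (Fpart G) [set: 'I_d]%SET.
Implicit Types (i j k l L K : {set 'I_d}) (v : 'I_d).

Local Notation F := (Fpart G).

Lemma F_uniq i k v : i \in F -> k \in F -> v \in i -> v \in k -> i = k.
Proof.
have /and3P[_ trivF _] := F_partition.
by move=> iF kF vi vk; rewrite -(def_pblock trivF iF vi) (def_pblock trivF kF vk).
Qed.

Lemma F_neq0 i : i \in F -> exists v, v \in i.
Proof. by rewrite in_setD1 => /andP[/set0Pn[v vi] _]; exists v. Qed.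

Lemma F_disjoint i k : i \in F -> k \in F -> i != k -> [disjoint i & k]%B.
Proof.
move=> iF kF ik; rewrite disjoint_subset; apply/fintype.subsetP => v vi.
rewrite inE; apply/negP => vk.
by rewrite (F_uniq iF kF vi vk) eqxx in ik.
Qed.

Lemma small_F l : l \in small G -> l \in F.
Proof.
case: G_two_layer => _ sm _ ls; have [l0 _] := sm _ ls.
by rewrite in_setD1 finset.in_setU l0 ls.
Qed.

Lemma redgesP L l : L \in parents G l ->
  [/\ L \in large G, l \in small G & l \subset L].
Proof. by case: G_two_layer => _ _ h; rewrite inE; exact: h. Qed.

Lemma childrenE L l : (l \in children G L) = (L \in parents G l).
Proof. by rewrite !inE. Qed.

Lemma total_countE (P : pred {set 'I_d}) :
  total_count G P = #|[set L in large G | P L]%SET|%:Z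
    + \sum_(l in small G | P l) (1 - #|parents G l|%:Z).
Proof.
rewrite /total_count; congr (_ + _); rewrite /cnum_large.
rewrite (eq_bigl (fun L => L \in [set L in large G | P L]%SET)) ?sumr_const ?natz //.
by move=> L; rewrite inE.
Qed.

(** The small set l is the only one that contains v, so counting v once forces
    the number of large regions around v to be the number of parents of l. *)
Lemma small_parents l v : l \in small G -> v \in l ->
  parents G l = [set L in large G | v \in L]%SET.
Proof.
move=> ls vl; apply/eqP; rewrite eqEcard; apply/andP; split.
  apply/fintype.subsetP => L /redgesP[LG _ lL]; rewrite inE LG /=.
  exact: (fintype.subsetP lL).
have := G_valid.1 v; rewrite total_countE (bigD1 l) ?ls //= big1 ?addr0.
  move/eqP; rewrite addrCA -subr_eq0 addrAC subrr add0r subr_eq0 eqz_nat.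
  by move/eqP->.
move=> k /andP[/andP[ks vk] /negP[]]; apply/eqP.
exact: F_uniq (small_F ks) (small_F ls) vk vl.
Qed.

(** No small region contains v, so counting v once leaves room for a single
    large region. *)
Lemma residual_large i v L K : i \in F -> i \notin small G -> v \in i ->
  L \in large G -> K \in large G -> v \in L -> v \in K -> L = K.
Proof.
move=> iF ins vi LG KG vL vK.
have := G_valid.1 v; rewrite total_countE big1 ?addr0.
  move=> [] /eqP /cards1P[M ME].
  have : L \in [set M]%SET by rewrite -ME inE LG.
  have : K \in [set M]%SET by rewrite -ME inE KG.
  by rewrite !inE => /eqP -> /eqP ->.
move=> k /andP[ks vk]; case/negP: ins.
by rewrite (F_uniq iF (small_F ks) vi vk).
Qed.

(** So every large region is the disjoint union of the blocks that it contains. *)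
Lemma block_subset k L v : k \in F -> L \in large G -> v \in k -> v \in L ->
  k \subset L.
Proof.
move=> kF LG vk vL; have [ks|kns] := boolP (k \in small G).
  suff : L \in parents G k by case/redgesP.
  by rewrite (small_parents ks vk) inE LG.
have := kF; rewrite in_setD1 finset.in_setU (negPf kns) => /andP[_] /=.
case/imsetP => K KG kE.
have vK : v \in K by move: vk; rewrite kE => /setDP[].
by rewrite (residual_large kF kns vk LG KG vL vK) kE subsetDl.
Qed.

Lemma block_disjoint k L : k \in F -> L \in large G -> ~~ (k \subset L) ->
  [disjoint k & L]%B.
Proof.
move=> kF LG nkL; rewrite disjoint_subset; apply/fintype.subsetP => v vk.
rewrite inE; apply: contra nkL => vL; exact: block_subset vk vL.
Qed.

Definition larges_over i : {set {set 'I_d}} :=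
  [set L in large G | i \subset L]%SET.

(** If i is not small, L is the only large region around it and both sides are
    empty; if i is small, all large regions around it are parents. *)
Lemma parents_larges_over i L : i \in F -> L \in large G -> i \subset L ->
  (parents G i :\ L = larges_over i :\ L)%SET.
Proof.
move=> iF LG iL; have [v vi] := F_neq0 iF.
apply/setP => K; rewrite !in_setD1; have [//|/= KL] := eqVneq K L.
apply/idP/idP => [/redgesP[KG _ iK]|]; first by rewrite inE KG.
rewrite inE => /andP[KG iK].
have vK := fintype.subsetP iK _ vi; have vL := fintype.subsetP iL _ vi.
have [is_|ins] := boolP (i \in small G).
  by rewrite (small_parents is_ vi) inE KG.
by rewrite (residual_large iF ins vi KG LG vK vL) eqxx in KL.
Qed.

Lemma not_child_parents j L : j \in F -> L \in large G -> j \subset L ->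
  j \notin children G L -> parents G j = finset.set0.
Proof.
move=> jF LG jL; rewrite childrenE => nLj; have [v vj] := F_neq0 jF.
have [js|jns] := boolP (j \in small G).
  by move: nLj; rewrite (small_parents js vj) inE LG (fintype.subsetP jL).
apply/setP => K; rewrite finset.in_set0; apply/negP => /redgesP[_ js _].
by rewrite js in jns.
Qed.

(** A nonzero block contains an edge of the graph; no small region contains both
    of its ends, so the edge is counted by large regions only. *)
Lemma edge_large i k : i \in F -> k \in F -> i != k -> block A i k != 0 ->
  #|larges_over i :&: larges_over k| = 1%N.
Proof.
move=> iF kF ik A0.
have [a [c Aac]] : exists a c, block A i k a c != 0.
  apply: contrapT => h; move/eqP: A0; apply; apply/matrixP => a c.
  rewrite [RHS]mxE; apply/eqP/negPn/negP => hac; apply: h.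
  by exists a, c.
set u := enum_val a; set v := enum_val c.
have ui : u \in i by exact: enum_valP.
have vk : v \in k by exact: enum_valP.
have uv : adj A u v.
  rewrite /adj; move: Aac; rewrite mxE => ->; rewrite andbT.
  by apply/eqP => uv; move: ik; rewrite (F_uniq iF kF ui) ?eqxx // uv.
have := G_valid.2 _ _ uv; rewrite total_countE big1 ?addr0.
  case=> <-; apply: eq_card => L; rewrite !inE.
  have [LG /=|//] := boolP (L \in large G).
  congr (_ && _); apply/idP/idP.
  - by move/fintype.subsetP; apply.
  - exact: block_subset.
  - by move/fintype.subsetP; apply.
  - exact: block_subset.
move=> l /andP[ls /andP[ul vl]]; case/negP: ik; apply/eqP.
by rewrite (F_uniq iF (small_F ls) ui ul) (F_uniq kF (small_F ls) vk vl).
Qed.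

End Combinatorics.

Lemma unitmx_inj (R : fieldType) n (M : 'M[R]_n) :
  (forall y : 'cV_n, M *m y = 0 -> y = 0) -> M \in unitmx.
Proof.
move=> h; rewrite -unitmx_tr -row_free_unit; apply: inj_row_free => v vM.
apply: trmx_inj; rewrite trmx0; apply: h.
by rewrite -[M]trmxK -trmx_mul vM trmx0.
Qed.

(** * Defects of messages *)

Section Convergence.
Variables (R : realType) (d : nat) (A : 'M[R]_d) (b : 'cV[R]_d).
Variable G : region_graph d.
Hypothesis A_inv : A \in unitmx.
Hypothesis G_two_layer : two_layer A G.
Hypothesis G_valid : valid A G.
Hypothesis F_partition : finset.partition (Fpart G) [set: 'I_d]%SET.
Hypothesis det_Aii : forall i, i \in Fpart G -> \det (block A i i) != 0.
Variable N : forall k : {set 'I_d}, 'cV[R]_#|k| -> R.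
Hypothesis hN : forall i, i \in Fpart G -> vector_norm (@N i).
Implicit Types (i j k l L K : {set 'I_d}) (s : state R d).

Local Notation F := (Fpart G).

Definition Rnorm i k : R := opnorm (@N i) (@N k) (Rtilde A i k).

Variables (w : {set 'I_d} -> R) (th : R).
Hypothesis th01 : 0 < th < 1.
Hypothesis w_gt0 : forall i, i \in F -> 0 < w i.
Hypothesis hw : forall i, i \in F -> \sum_(k in F) Rnorm i k * w k <= th * w i.

Let xs : 'cV[R]_d := invmx A *m b.

Definition Dinv i := invmx (block A i i).

Definition inL L k := (k \in F) && (k \subset L).

Lemma Rnorm_ge0 i k : i \in F -> k \in F -> 0 <= Rnorm i k.
Proof. by move=> iF kF; apply: opnorm_ge0; exact: hN. Qed.

Lemma Rtilde_offdiag i k : i \in F -> k \in F -> k != i ->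
  Rtilde A i k = - (Dinv i *m block A i k).
Proof.
move=> iF kF ki; rewrite /Rtilde idblock_disjoint ?sub0r //.
by apply: (F_disjoint F_partition iF kF); rewrite eq_sym.
Qed.

Lemma Dinv_block_norm i k y : i \in F -> k \in F -> k != i ->
  @N i (Dinv i *m (block A i k *m y)) <= Rnorm i k * @N k y.
Proof.
move=> iF kF ki; have := opnormP (hN iF) (hN kF) (Rtilde A i k) y.
by rewrite {1}Rtilde_offdiag // mulNmx (vnormN (hN iF)) mulmxA.
Qed.

Lemma Rnorm_block0 i k : i \in F -> k \in F -> k != i -> block A i k = 0 ->
  Rnorm i k = 0.
Proof.
move=> iF kF ki A0; rewrite /Rnorm Rtilde_offdiag // A0 mulmx0 oppr0.
by apply: opnorm0; exact: hN.
Qed.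

(** Each k coupled to i shares exactly one large region with i, so summing over
    the large regions around i meets it once. *)
Lemma sum_larges_over (V : zmodType) i (f : {set 'I_d} -> V) : i \in F ->
  (forall k, k \in F -> k != i -> block A i k = 0 -> f k = 0) ->
  \sum_(L in larges_over G i) \sum_(k | inL L k && (k != i)) f k
  = \sum_(k in F | k != i) f k.
Proof.
move=> iF f0.
rewrite (exchange_big_dep (fun k => (k \in F) && (k != i))) /=; last first.
  by move=> L k _ /andP[/andP[-> _] ->].
apply: eq_bigr => k /andP[kF ki].
have [A0|A0] := eqVneq (block A i k) 0.
  by rewrite f0 // big1.
rewrite (eq_bigl (fun L => L \in larges_over G i :&: larges_over G k)%SET).
  rewrite sumr_const (edge_large G_two_layer G_valid F_partition iF kF _ A0) //.
  by rewrite eq_sym.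
move=> L; rewrite /inL kF ki andbT !inE.
by case: (L \in large G).
Qed.

(** The part of the row sum of l, weighted by w, that lies in L.  The budgets of
    all large regions around l add up to at most th * w l. *)
Definition budget L l : R := \sum_(k | inL L k && (k != l)) Rnorm l k * w k.

Lemma budget_sum i : i \in F ->
  \sum_(L in larges_over G i) budget L i <= th * w i.
Proof.
move=> iF; rewrite sum_larges_over //; last first.
  by move=> k kF ki A0; rewrite Rnorm_block0 // mul0r.
apply: le_trans (hw iF); rewrite [leRHS](bigD1 i) //= lerDr.
by rewrite mulr_ge0 ?Rnorm_ge0 // ltW ?w_gt0.
Qed.

Definition coupling L l : 'cV[R]_#|l| :=
  \sum_(k | inL L k && (k != l)) block A l k *m subvec xs k.

Lemma row_solution i : i \in F ->
  subvec b i = block A i i *m subvec xs i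
               + \sum_(L in larges_over G i) coupling L i.
Proof.
move=> iF; rewrite sum_larges_over //; last first.
  by move=> k _ _ ->; rewrite mul0mx.
have -> : b = A *m xs by rewrite /xs mulmxA mulmxV // mul1mx.
by rewrite (subvec_mulmx F_partition) (bigD1 i).
Qed.

(** Writing xs for the exact solution, the pair of messages from L to l stands
    for the affine map u |-> Lam u - m on the block l, which should account for
    the coupling of l to the rest of L.  This is the defect of that
    replacement at u = xs_l. *)
Definition defect s L l : 'cV[R]_#|l| :=
  msg s L l - msgLam s L l *m subvec xs l + coupling L l.

Definition in_defect s L l : 'cV[R]_#|l| :=
  \sum_(K in (parents G l :\ L)%SET) defect s K l.

Lemma idblock_child L j l : l \in children G L -> j \in F ->
  j != l -> idblock j l = 0 :> 'M[R]_(_, _).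
Proof.
rewrite childrenE => /(redgesP G_two_layer)[_ ls _] jF jl.
apply: idblock_disjoint; apply: (F_disjoint F_partition jF _ jl).
exact: small_F G_two_layer _ ls.
Qed.

(** * Local systems *)

Section Rows.
Variables (s : state R d) (L : {set 'I_d}).
Hypothesis LG : L \in large G.

(** The matrix incoming at j occurs in row j only: the children of L are
    pairwise disjoint, and a block of L that is no child has no parent. *)
Lemma Lam0_row j (y : 'cV[R]_#|L|) : inL L j ->
  restr_vec j (Lam0 A G s L *m y) =
    block A j j *m restr_vec j y
    + \sum_(k | inL L k && (k != j)) block A j k *m restr_vec k y
    + in_Lam G s L j *m restr_vec j y.
Proof.
move=> /andP[jF jL]; rewrite /restr_vec /Lam0 mulmxDl mulmxDr; congr (_ + _).
  rewrite mulmxA idblock_block // (block_sum F_partition A j L).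
  rewrite mulmx_suml [LHS](bigD1 j) //= -mulmxA; congr (_ + _).
  rewrite [LHS](bigID (fun k => k \subset L)) /= [X in _ + X]big1 ?addr0; last first.
    move=> k /andP[/andP[kF _] nkL]; rewrite idblock_disjoint ?mulmx0 ?mul0mx //.
    exact: (block_disjoint G_two_layer G_valid F_partition kF LG nkL).
  rewrite (eq_bigl (fun k => inL L k && (k != j))); last first.
    by move=> k; rewrite /inL andbAC.
  by apply: eq_bigr => k _; rewrite mulmxA.
have [jc|jc] := boolP (j \in children G L).
  rewrite (bigD1 j) //= mulmxDl mulmxDr [X in _ + X](_ : _ = 0) ?addr0.
    rewrite /in_Lam !mulmx_suml mulmx_sumr; apply: eq_bigr => K _.
    rewrite /ext_mx !mulmxA idblock_mul // idblock_refl mul1mx.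
    by rewrite -!mulmxA.
  rewrite mulmx_suml mulmx_sumr; apply: big1 => l /andP[lc lj].
  rewrite mulmx_suml mulmx_sumr; apply: big1 => K _.
  rewrite /ext_mx !mulmxA idblock_mul // (@idblock_child L) ?mul0mx //.
  by rewrite eq_sym.
rewrite /in_Lam (not_child_parents G_two_layer G_valid F_partition jF LG jL jc).
rewrite finset.set0D finset.big_set0 mul0mx mulmx_suml mulmx_sumr; apply: big1 => l lc.
rewrite mulmx_suml mulmx_sumr; apply: big1 => K _.
rewrite /ext_mx !mulmxA idblock_mul // (@idblock_child L) ?mul0mx //.
by apply: contraNneq jc => ->.
Qed.

Lemma b0_row j : inL L j -> restr_vec j (b0 b G s L) = subvec b j + in_m G s L j.
Proof.
move=> /andP[jF jL]; rewrite /restr_vec /b0 mulmxDr idblock_subvec //; congr (_ + _).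
have [jc|jc] := boolP (j \in children G L).
  rewrite (bigD1 j) //= mulmxDr [X in _ + X](_ : _ = 0) ?addr0.
    rewrite /in_m mulmx_sumr; apply: eq_bigr => K _.
    by rewrite /ext_vec !mulmxA idblock_mul // idblock_refl mul1mx.
  rewrite mulmx_sumr; apply: big1 => l /andP[lc lj].
  rewrite mulmx_sumr; apply: big1 => K _.
  rewrite /ext_vec !mulmxA idblock_mul // (@idblock_child L) ?mul0mx //.
  by rewrite eq_sym.
rewrite /in_m (not_child_parents G_two_layer G_valid F_partition jF LG jL jc).
rewrite finset.set0D finset.big_set0 mulmx_sumr; apply: big1 => l lc.
rewrite mulmx_sumr; apply: big1 => K _.
rewrite /ext_vec !mulmxA idblock_mul // (@idblock_child L) ?mul0mx //.
by apply: contraNneq jc => ->.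
Qed.

(** The exact solution satisfies the local system of L up to the defects of the
    messages sent to j by the other large regions: by the row j of A xs = b,
    what the messages replace is the sum of the couplings of j in the large
    regions other than L. *)
Lemma residual_row j : inL L j ->
  restr_vec j (b0 b G s L - Lam0 A G s L *m subvec xs L) = in_defect s L j.
Proof.
move=> jJ; have /andP[jF jL] := jJ.
rewrite /restr_vec mulmxBr -!/(restr_vec _ _) b0_row // Lam0_row //.
rewrite /restr_vec idblock_subvec // row_solution //.
rewrite (bigD1 L) /=; last by rewrite inE LG.
have -> : \sum_(k | inL L k && (k != j)) block A j k *m (idblock k L *m subvec xs L)
    = coupling L j.
  by apply: eq_bigr => k /andP[/andP[_ kL] _]; rewrite idblock_subvec.
rewrite /in_defect /defect big_split /= sumrB /in_Lam mulmx_suml -/(in_m G s L j).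
rewrite (eq_bigl (fun K => K \in larges_over G j :\ L)%SET); last first.
  by move=> K; rewrite !inE andbC.
rewrite -(parents_larges_over G_two_layer G_valid F_partition jF LG jL).
set X := \sum_(i in _) coupling i j; set Y := \sum_(i in _) _ *m _.
set Z := in_m _ _ _ _; set P := block A j j *m _; set Q := coupling L j.
rewrite addrA; set S := P + Q; rewrite opprD addrA.
by rewrite -[S + X + Z]addrA [S + _]addrC addrK [X + Z]addrC addrAC.
Qed.

Lemma restr_eq0 (y : 'cV[R]_#|L|) :
  (forall k, inL L k -> restr_vec k y = 0) -> y = 0.
Proof.
move=> y0; rewrite -[y]mul1mx -(idblock_refl _ L) /idblock.
rewrite (block_sum F_partition 1%:M L L) mulmx_suml; apply: big1 => k kF.
rewrite -mulmxA; have [kL|kL] := boolP (k \subset L).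
  by rewrite [idblock k L *m y]y0 ?mulmx0 // /inL kF.
rewrite idblock_disjoint ?mul0mx ?mulmx0 //.
exact: (block_disjoint G_two_layer G_valid F_partition kF LG kL).
Qed.

(** * Norm bounds for local solutions *)

Section Bounds.
Variable ep : R.
Hypothesis ep_gt0 : 0 < ep.

(** What the defect of the messages, measured in units of ep, leaves of the
    budget. *)
Definition slack K l : R := budget K l - N (Dinv l *m defect s K l) / ep.

(** The invariant of the algorithm: in the norm scaled by the inverse diagonal
    block, the message matrix and the defect share the budget of l in L, a large
    matrix being allowed only with a small defect.  Bounding the two separately
    by the whole budget would only yield the factor th / (1 - th). *)
Definition good K l : Prop := forall u : 'cV[R]_#|l|,
  w l * N (Dinv l *m (msgLam s K l *m u)) <= slack K l * N u.

Hypothesis s_good : forall K l, l \in children G K -> good K l.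

Lemma child_F K l : l \in children G K -> l \in F.
Proof.
rewrite childrenE => /(redgesP G_two_layer)[_ ls _].
exact: small_F G_two_layer _ ls.
Qed.

Lemma vnorm_gt0_ex l : l \in F -> exists u : 'cV[R]_#|l|, 0 < N u.
Proof.
move=> lF; have [v vl] := F_neq0 lF.
exists (const_mx 1); rewrite lt_neqAle vnorm_ge0 ?andbT; last exact: hN.
rewrite eq_sym; apply/eqP => /(vnorm_eq0 (hN lF)) /matrixP /(_ (enum_rank_in vl v) 0).
by rewrite !mxE => /eqP; rewrite oner_eq0.
Qed.

Lemma slack_ge0 K l : l \in children G K -> 0 <= slack K l.
Proof.
move=> lc; have lF := child_F lc; have [u u0] := vnorm_gt0_ex lF.
rewrite -(pmulr_lge0 _ u0); apply: le_trans (s_good lc u).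
by rewrite mulr_ge0 ?vnorm_ge0 ?(ltW (w_gt0 lF)) //; exact: hN.
Qed.

Definition other j : {set {set 'I_d}} := (parents G j :\ L)%SET.

Lemma other_child j K : K \in other j -> j \in children G K.
Proof. by rewrite !inE => /andP[]. Qed.

Definition in_budget j : R := \sum_(K in other j) budget K j.
Definition in_slack j : R := \sum_(K in other j) slack K j.

Lemma budget_le j : inL L j -> budget L j + in_budget j <= th * w j.
Proof.
move=> /andP[jF jL]; apply: le_trans (budget_sum jF).
rewrite [leRHS](bigD1 L) /=; last by rewrite inE LG.
rewrite lerD2l /in_budget /other.
rewrite (parents_larges_over G_two_layer G_valid F_partition jF LG jL).
rewrite (eq_bigl _ _ (fun K => in_setD1 K _ _)).
by rewrite le_eqVlt; apply/orP; left; apply/eqP/eq_bigl => K; rewrite andbC.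
Qed.

Lemma in_slack_bounds j : j \in F -> 0 <= in_slack j <= in_budget j.
Proof.
move=> jF; apply/andP; split.
  by apply: sumr_ge0 => K /other_child; exact: slack_ge0.
apply: ler_sum => K _; rewrite /slack gerBl divr_ge0 ?(ltW ep_gt0) //.
by rewrite vnorm_ge0 //; exact: hN.
Qed.

Lemma in_Lam_norm j u : j \in F ->
  w j * N (Dinv j *m (in_Lam G s L j *m u)) <= in_slack j * N u.
Proof.
move=> jF; rewrite /in_Lam mulmx_suml mulmx_sumr.
apply: le_trans (_ : w j * (\sum_(K in other j) N (Dinv j *m (msgLam s K j *m u))) <= _).
  by rewrite ler_pM2l ?w_gt0 // (vnorm_sum (hN jF)).
rewrite mulr_sumr /in_slack mulr_suml; apply: ler_sum => K Kj.
exact: s_good (other_child Kj) u.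
Qed.

Lemma in_defect_norm j : j \in F ->
  N (Dinv j *m in_defect s L j) <= ep * (in_budget j - in_slack j).
Proof.
move=> jF; rewrite /in_defect mulmx_sumr.
apply: le_trans (vnorm_sum (hN jF) _ _ _) _.
rewrite /in_budget /in_slack -sumrB mulr_sumr; apply: ler_sum => K _.
by rewrite /slack opprB addrC subrK mulrCA mulfV ?mulr1 ?gt_eqF.
Qed.

(** Row j of the local system, solved for the block j of y. *)
Lemma row_norm j (y : 'cV[R]_#|L|) : inL L j ->
  w j * N (restr_vec j y) <=
  w j * (N (Dinv j *m restr_vec j (Lam0 A G s L *m y))
         + \sum_(k | inL L k && (k != j)) Rnorm j k * N (restr_vec k y))
  + in_slack j * N (restr_vec j y).
Proof.
move=> jJ; have /andP[jF jL] := jJ.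
rewrite Lam0_row // !mulmxDr.
have -> : Dinv j *m (block A j j *m restr_vec j y) = restr_vec j y.
  by rewrite mulmxA mulVmx ?mul1mx // unitmxE unitfE det_Aii.
set yj := restr_vec j y; set X := Dinv j *m \sum_(k | _) _; set Y := Dinv j *m _.
have hj := hN jF.
have h1 : N yj <= N (yj + X + Y) + (N X + N Y).
  rewrite -[yj in leLHS](addrK (X + Y)) addrA.
  apply: le_trans (vnorm_triangle hj _ _) _; rewrite lerD2l vnormN //.
  exact: vnorm_triangle.
have h2 : N X <= \sum_(k | inL L k && (k != j)) Rnorm j k * N (restr_vec k y).
  rewrite /X mulmx_sumr; apply: le_trans (vnorm_sum hj _ _ _) _.
  by apply: ler_sum => k /andP[/andP[kF _] kj]; exact: Dinv_block_norm.
have h3 : w j * N Y <= in_slack j * N yj by exact: in_Lam_norm.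
apply: le_trans (_ : w j * (N (yj + X + Y) + (N X + N Y)) <= _).
  by rewrite ler_pM2l ?w_gt0.
rewrite addrA mulrDr lerD // ler_pM2l ?w_gt0 //.
by rewrite lerD2l.
Qed.

Lemma solution_bound (ep' : R) (y : 'cV[R]_#|L|) : 0 <= ep' ->
  (forall j, inL L j -> N (Dinv j *m restr_vec j (Lam0 A G s L *m y))
     <= ep' * (in_budget j - in_slack j)) ->
  forall j, inL L j -> N (restr_vec j y) <= th * ep' * w j.
Proof.
move=> ep0 hf; apply: (@comparison_principle _ _ (inL L) Rnorm w _ (fun=> 0)
   in_budget in_slack th ep' 0 th01 ep0).
- by rewrite mulr_ge0 // ltW; case/andP: th01.
- by move=> j /andP[jF _]; exact: w_gt0.
- by move=> j k /andP[jF _] /andP[kF _]; exact: Rnorm_ge0.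
- by [].
- by move=> j /andP[jF _]; exact: in_slack_bounds.
- by move=> j jJ; rewrite addr0; exact: budget_le.
move=> j jJ; have := row_norm y jJ; have := hf _ jJ => h1 h2.
have /andP[jF _] := jJ.
apply: le_trans h2 _; rewrite mulr0 addr0 mulrDr -addrA [leLHS]addrC lerD2l.
by rewrite ler_pM2l ?w_gt0.
Qed.

Lemma sum_inL_split (f : {set 'I_d} -> R) j l : inL L l -> j != l ->
  \sum_(k | inL L k && (k != j)) f k =
  \sum_(k | (inL L k && (k != l)) && (k != j)) f k + f l.
Proof.
move=> lJ jl; rewrite (bigD1 l) /=; last by rewrite lJ eq_sym.
by rewrite addrC; congr (_ + _); apply: eq_bigl => k; rewrite andbAC.
Qed.

(** Here the block l is prescribed, so the comparison runs over the other blocks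
    of L, and the column of l becomes the source term g of the comparison
    principle.  One estimate for a combination of y and z is needed because the
    defect (given by y) and the message matrix (given by z) share one budget. *)
Lemma schur_bound (ep' c1 c2 : R) l (y z : 'cV[R]_#|L|) :
  0 <= ep' -> 0 <= c1 -> 0 <= c2 -> inL L l ->
  restr_vec l y = 0 -> c2 * N (restr_vec l z) <= th * ep' * w l ->
  (forall j, inL L j -> j != l ->
     c1 * N (Dinv j *m restr_vec j (Lam0 A G s L *m y))
     <= ep' * (in_budget j - in_slack j)) ->
  (forall j, inL L j -> j != l -> restr_vec j (Lam0 A G s L *m z) = 0) ->
  forall j, inL L j -> j != l ->
    c1 * N (restr_vec j y) + c2 * N (restr_vec j z) <= th * ep' * w j.
Proof.
move=> ep0 c10 c20 lJ yl zl hy hz j jJ jl; have /andP[lF _] := lJ.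
pose J k := inL L k && (k != l).
apply: (@comparison_principle _ _ J Rnorm w
   (fun j => c1 * N (restr_vec j y) + c2 * N (restr_vec j z))
   (fun j => Rnorm j l * w l) in_budget in_slack th ep'
   (c2 * N (restr_vec l z) / w l) th01 ep0); last by rewrite /J jJ.
- by rewrite ler_pdivrMr ?w_gt0.
- by move=> i /andP[/andP[iF _] _]; exact: w_gt0.
- by move=> i k /andP[/andP[iF _] _] /andP[/andP[kF _] _]; exact: Rnorm_ge0.
- move=> i /andP[/andP[iF _] _].
  by rewrite mulr_ge0 ?Rnorm_ge0 // ltW ?w_gt0.
- by move=> i /andP[/andP[iF _] _]; exact: in_slack_bounds.
- move=> i /andP[iJ il]; rewrite -(sum_inL_split (fun k => Rnorm i k * w k) lJ il).
  exact: budget_le.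
move=> i /andP[iJ il]; have /andP[iF _] := iJ.
have w0 := w_gt0 iF.
have ry := row_norm y iJ; have rz := row_norm z iJ.
rewrite hz // mulmx0 (vnorm0 (hN iF)) add0r in rz.
rewrite (sum_inL_split _ lJ il) in ry; rewrite (sum_inL_split _ lJ il) in rz.
rewrite yl (vnorm0 (hN lF)) mulr0 addr0 in ry.
have fy : w i * (c1 * N (Dinv i *m restr_vec i (Lam0 A G s L *m y)))
   <= w i * (ep' * (in_budget i - in_slack i)) by rewrite ler_pM2l // hy.
have -> : Rnorm i l * w l * (c2 * N (restr_vec l z) / w l)
        = c2 * (Rnorm i l * N (restr_vec l z)).
  rewrite mulrACA [w l * _]mulrC.
  by rewrite -mulrA mulVf ?mulr1 ?gt_eqF ?w_gt0 // mulrCA.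
have -> : \sum_(k | J k && (k != i)) Rnorm i k * (c1 * N (restr_vec k y) + c2 * N (restr_vec k z))
   = c1 * (\sum_(k | J k && (k != i)) Rnorm i k * N (restr_vec k y))
   + c2 * (\sum_(k | J k && (k != i)) Rnorm i k * N (restr_vec k z)).
  rewrite !mulr_sumr -big_split /=; apply: eq_bigr => k _.
  by rewrite mulrDr !(mulrCA (Rnorm i k)).
have := ler_wpM2l c10 ry; have := ler_wpM2l c20 rz; move: fy; rewrite -/(J _).
set f := N (Dinv i *m _); set sy := \sum_(k | _) _; set sz := \sum_(k | _) _.
set ny := N (restr_vec i y); set nz := N (restr_vec i z).
set nl := N (restr_vec l z).
move: (w i) (in_slack i) (Rnorm i l) (in_budget i).
clearbody f sy sz ny nz nl.
move=> wi isl r ib h1 h2 h3.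
rewrite !(mulrDr, mulrDl) !(mulrCA c1) !(mulrCA c2) in h1 h2 h3 *.
lra.
Qed.

Lemma vnorm_le0 j (x : 'cV[R]_#|j|) : j \in F -> N x <= 0 -> x = 0.
Proof.
move=> jF x0; apply: (vnorm_eq0 (hN jF)); apply/eqP.
by rewrite eq_le x0 vnorm_ge0 //; exact: hN.
Qed.

(** A vector in the kernel satisfies solution_bound with ep' = 0. *)
Lemma Lam0_unit : Lam0 A G s L \in unitmx.
Proof.
apply: unitmx_inj => y My; apply: restr_eq0 => k kJ; have /andP[kF _] := kJ.
apply: (vnorm_le0 kF); rewrite -[leRHS](mul0r (w k)) -(mulr0 th).
apply: solution_bound kJ => // j /andP[jF _].
by rewrite My /restr_vec !mulmx0 (vnorm0 (hN jF)) mul0r.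
Qed.

(** * Updating the messages to one child *)

Section Child.
Variable l : {set 'I_d}.
Hypothesis lc : l \in children G L.

Lemma child_inL : inL L l.
Proof.
rewrite /inL (child_F lc) /=.
by move: lc; rewrite childrenE => /(redgesP G_two_layer)[].
Qed.

Let lL : l \subset L. Proof. by case/andP: child_inL. Qed.

Lemma restr_vec_ext j (c : 'cV[R]_#|l|) : inL L j -> j != l ->
  restr_vec j (idblock L l *m c) = 0.
Proof.
move=> /andP[jF jL] jl.
by rewrite /restr_vec mulmxA idblock_mul // (idblock_child lc jF jl) mul0mx.
Qed.

(** If c is in the kernel, the local solution with right-hand side c on l
    vanishes on l and has no forcing elsewhere, so it is zero by schur_bound with
    ep' = 0. *)
Lemma restr_unit : restr_mx l (invmx (Lam0 A G s L)) \in unitmx.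
Proof.
apply: unitmx_inj => c; rewrite /restr_mx -!mulmxA; set y := _ *m (_ *m c) => yl.
have My : Lam0 A G s L *m y = idblock L l *m c by rewrite mulKVmx ?Lam0_unit.
have y0 : y = 0.
  apply: restr_eq0 => j jJ; have [->//|jl] := eqVneq j l.
  have /andP[jF _] := jJ; apply: (vnorm_le0 jF).
  have := @schur_bound 0 1 0 l y 0 (lexx _) ler01 (lexx _) child_inL yl _ _ _ j jJ jl.
  rewrite !mul0r mulr0 !mul0r addr0 mul1r; apply=> //.
    move=> i iJ il; have /andP[iF _] := iJ.
    by rewrite My restr_vec_ext // mulmx0 (vnorm0 (hN iF)) mulr0 mul0r.
  by move=> i iJ il; rewrite mulmx0 /restr_vec mulmx0.
have : idblock l L *m (idblock L l *m c) = 0 by rewrite -My y0 !mulmx0.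
by rewrite mulmxA idblock_mul // idblock_refl mul1mx.
Qed.

(** schur is the Schur complement of Lam0 on l; extend u is the vector equal to u
   on l whose image under Lam0 vanishes on the other blocks; xrest is the error
   of the new local solution, corrected to vanish on l. *)
Let schur : 'M[R]_#|l| := invmx (restr_mx l (invmx (Lam0 A G s L))).
Let extend (u : 'cV[R]_#|l|) : 'cV[R]_#|L| :=
  invmx (Lam0 A G s L) *m (idblock L l *m (schur *m u)).
Let xerr : 'cV[R]_#|L| := new_x A b G s L - subvec xs L.
Let xrest : 'cV[R]_#|L| := xerr - extend (restr_vec l xerr).

Lemma Lam0_extend u : Lam0 A G s L *m extend u = idblock L l *m (schur *m u).
Proof. by rewrite mulKVmx ?Lam0_unit. Qed.

Lemma extend_l u : restr_vec l (extend u) = u.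
Proof.
rewrite /restr_vec /extend; have := mulmxV restr_unit => /(congr1 (mulmx^~ u)).
by rewrite /= mul1mx {1}/restr_mx -!mulmxA.
Qed.

Lemma Lam0_extend_l u : restr_vec l (Lam0 A G s L *m extend u) = schur *m u.
Proof.
by rewrite Lam0_extend /restr_vec mulmxA idblock_mul // idblock_refl mul1mx.
Qed.

Lemma Lam0_extend_other u j : inL L j -> j != l ->
  restr_vec j (Lam0 A G s L *m extend u) = 0.
Proof. by move=> jJ jl; rewrite Lam0_extend restr_vec_ext. Qed.

Lemma Lam0_xerr j : inL L j -> restr_vec j (Lam0 A G s L *m xerr) = in_defect s L j.
Proof.
move=> jJ; rewrite -residual_row // /xerr mulmxBr mulKVmx //.
exact: Lam0_unit.
Qed.

Lemma xrest_l : restr_vec l xrest = 0.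
Proof. by rewrite /restr_vec mulmxBr -/(restr_vec _ _) [X in _ - X]extend_l subrr. Qed.

Lemma Lam0_xrest_other j : inL L j -> j != l ->
  restr_vec j (Lam0 A G s L *m xrest) = in_defect s L j.
Proof.
move=> jJ jl; rewrite mulmxBr /restr_vec mulmxBr.
by rewrite [X in X - _]Lam0_xerr // [X in _ - X]Lam0_extend_other // subr0.
Qed.

(** Row l of Lam0 (extend u) is schur u; the diagonal block and the incoming
    matrices are subtracted in the update. *)
Lemma new_LamE u : new_Lam A G s L l *m u =
  \sum_(k | inL L k && (k != l)) block A l k *m restr_vec k (extend u).
Proof.
have := Lam0_row (extend u) child_inL; rewrite Lam0_extend_l extend_l => E.
rewrite /new_Lam -/schur !mulmxBl E /submat.
by rewrite addrAC addrK addrAC subrr add0r.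
Qed.

(** The defect of the new messages does not see xs any more: it is linear in
    xrest, hence in the incoming defects. *)
Lemma new_defectE :
  new_m A b G s L l - new_Lam A G s L l *m subvec xs l + coupling L l =
  - \sum_(k | inL L k && (k != l)) block A l k *m restr_vec k xrest.
Proof.
have Ey := Lam0_row xrest child_inL; rewrite xrest_l !mulmx0 addr0 add0r in Ey.
have My : restr_vec l (Lam0 A G s L *m xrest) = in_defect s L l - schur *m restr_vec l xerr.
  rewrite /xrest mulmxBr /restr_vec mulmxBr.
  by rewrite [X in X - _]Lam0_xerr ?child_inL // [X in _ - X]Lam0_extend_l.
have hl : restr_vec l xerr = restr_vec l (new_x A b G s L) - subvec xs l.
  by rewrite /restr_vec mulmxBr idblock_subvec.
have El : in_defect s L l = subvec b l + in_m G s L l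
    - (block A l l *m subvec xs l + coupling L l + in_Lam G s L l *m subvec xs l).
  rewrite -residual_row ?child_inL // {1}/restr_vec mulmxBr -!/(restr_vec _ _).
  rewrite b0_row ?child_inL // Lam0_row ?child_inL //.
  rewrite /restr_vec idblock_subvec //.
  congr (_ - (_ + _ + _)); apply: eq_bigr => k /andP[/andP[_ kL] _].
  by rewrite idblock_subvec.
rewrite -Ey My El hl /new_m /new_Lam -/schur /submat !mulmxBl mulmxBr.
move: (schur *m restr_vec l _) (schur *m subvec xs l) (block A l l *m _) (coupling L l).
move: (in_Lam _ _ _ _ *m _) (in_m _ _ _ _) (subvec b l) => v1 v2 v3 v4 v5 v6 v7.
by apply/matrixP => i c; rewrite !mxE; ring.
Qed.

(** Apply schur_bound to xrest and extend u with the weights N u and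
    th * ep * w l, and sum the resulting bounds along row l: the sum of the
    right-hand sides is the budget. *)
Lemma new_good u :
  w l * N (Dinv l *m (new_Lam A G s L l *m u)) <=
  (budget L l - N (Dinv l *m (new_m A b G s L l
     - new_Lam A G s L l *m subvec xs l + coupling L l)) / (th * ep)) * N u.
Proof.
have lF := child_F lc; have hl := hN lF.
have te0 : 0 < th * ep by rewrite mulr_gt0 //; case/andP: th01.
have nu0 : 0 <= N u by exact: vnorm_ge0.
have bnd j : inL L j -> j != l ->
   N u * N (restr_vec j xrest) + th * ep * w l * N (restr_vec j (extend u))
   <= th * (ep * N u) * w j.
  apply: schur_bound => //.
  - by rewrite mulr_ge0 // ltW.
  - by rewrite mulr_ge0 ?ltW // w_gt0.
  - exact: child_inL.
  - exact: xrest_l.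
  - by rewrite extend_l mulrA mulrAC.
  - move=> i iJ il; have /andP[iF _] := iJ.
    rewrite Lam0_xrest_other // (mulrC ep) -mulrA.
    by rewrite ler_wpM2l // in_defect_norm.
  - by move=> i iJ il; rewrite Lam0_extend_other.
rewrite new_defectE new_LamE mulmxN (vnormN hl).
set X := N _; set Y := N (Dinv l *m _).
have sumle (v : 'cV[R]_#|L|) :
  N (Dinv l *m \sum_(k | inL L k && (k != l)) block A l k *m restr_vec k v)
  <= \sum_(k | inL L k && (k != l)) Rnorm l k * N (restr_vec k v).
  rewrite mulmx_sumr; apply: le_trans (vnorm_sum hl _ _ _) _.
  by apply: ler_sum => k /andP[/andP[kF _] kl]; exact: Dinv_block_norm.
suff : th * ep * w l * X + N u * Y <= th * ep * (N u * budget L l).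
  move=> H; rewrite -(ler_pM2l te0).
  have te_neq0 : th * ep != 0 by rewrite gt_eqF.
  have -> : th * ep * ((budget L l - Y / (th * ep)) * N u)
      = th * ep * (N u * budget L l) - N u * Y.
    by move: te_neq0; set t := th * ep => t_neq0; field.
  by rewrite lerBrDr; move: H; rewrite -[th * ep * w l * X]mulrA.
have hX : th * ep * w l * X <= th * ep * w l *
    \sum_(k | inL L k && (k != l)) Rnorm l k * N (restr_vec k (extend u)).
  by rewrite ler_wpM2l ?sumle // mulr_ge0 ?ltW // w_gt0.
have hY : N u * Y <= N u *
    \sum_(k | inL L k && (k != l)) Rnorm l k * N (restr_vec k xrest).
  by rewrite ler_wpM2l ?sumle.
apply: le_trans (lerD hX hY) _.
rewrite /budget !mulr_sumr -big_split /=; apply: ler_sum => k /andP[kJ kl].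
have /andP[kF _] := kJ.
have := ler_wpM2l (Rnorm_ge0 lF kF) (bnd k kJ kl).
set r := Rnorm l k; set a := N (restr_vec k xrest); set c := N (restr_vec k (extend u)).
set n := N u.
have -> : th * ep * w l * (r * c) + n * (r * a) = r * (n * a + th * ep * w l * c).
  by ring.
by have -> : th * ep * (n * (r * w k)) = r * (th * (ep * n) * w k) by ring.
Qed.

End Child.

Lemma new_x_bound j : inL L j ->
  N (restr_vec j (new_x A b G s L - subvec xs L)) <= th * ep * w j.
Proof.
apply: solution_bound; first exact: ltW.
move=> i iJ; have /andP[iF _] := iJ.
by rewrite Lam0_xerr // in_defect_norm.
Qed.

End Bounds.
End Rows.

(** * Sweeps *)

Definition all_good s ep : Prop :=
  forall K l, l \in children G K -> good s ep K l.

Definition xval_close s ep L : Prop := forall j, inL L j ->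
  N (restr_vec j (xval s L - subvec xs L)) <= ep * w j.

Lemma good_ext s t ep K l : msg s K l = msg t K l ->
  msgLam s K l = msgLam t K l -> good s ep K l -> good t ep K l.
Proof. by rewrite /good /slack /defect => -> ->. Qed.

Lemma good_mono s ep ep' K l : 0 < ep -> ep <= ep' -> l \in children G K ->
  good s ep K l -> good s ep' K l.
Proof.
move=> ep0 epe lc gd u; have hl := hN (child_F lc).
apply: le_trans (gd u) _; rewrite ler_wpM2r ?vnorm_ge0 //.
rewrite /slack lerD2l lerN2 ler_wpM2l ?vnorm_ge0 //.
by rewrite lef_pV2 ?posrE // (lt_le_trans ep0).
Qed.

Lemma update_defined_good s ep L : L \in large G -> 0 < ep -> all_good s ep ->
  update_defined A G s L.
Proof.
move=> LG ep0 gd; split; first exact: (Lam0_unit LG ep0 gd).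
by move=> l lc; exact: (restr_unit LG ep0 gd lc).
Qed.

Lemma update_good s ep L : L \in large G -> 0 < ep -> all_good s ep ->
  (forall l, l \in children G L -> good (update A b G s L) (th * ep) L l)
  /\ xval_close (update A b G s L) (th * ep) L.
Proof.
move=> LG ep0 gd; split.
  move=> l lc u; rewrite /slack /defect /= eqxx lc /=.
  exact: (new_good LG ep0 gd lc u).
move=> j jJ; rewrite /= eqxx.
exact: (new_x_bound LG ep0 gd jJ).
Qed.

Lemma update_other s ep L K l : K != L -> good s ep K l ->
  good (update A b G s L) ep K l.
Proof. by move=> KL; apply: good_ext; rewrite /= (negPf KL). Qed.

Let th0 : 0 < th. Proof. by case/andP: th01. Qed.
Let th1 : th < 1. Proof. by case/andP: th01. Qed.

(** Messages that are not yet updated stay good for ep, those already updated are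
    good for th * ep, so the whole sweep gains the factor th whatever the
    order. *)
Lemma sweep_good s ep o : 0 < ep -> {subset o <= large G} -> all_good s ep ->
  all_good (sweep A b G o s) ep /\
  forall K, K \in o ->
    (forall l, l \in children G K -> good (sweep A b G o s) (th * ep) K l)
    /\ xval_close (sweep A b G o s) (th * ep) K.
Proof.
move=> ep0; elim/last_ind: o => [|o L IH] oG gd; first by split.
have LG : L \in large G by apply: oG; rewrite mem_rcons mem_head.
have [gd1 gd2] : all_good (sweep A b G o s) ep /\ forall K, K \in o ->
    (forall l, l \in children G K -> good (sweep A b G o s) (th * ep) K l)
    /\ xval_close (sweep A b G o s) (th * ep) K.
  by apply: IH => // K Ko; apply: oG; rewrite mem_rcons inE Ko orbT.
have sE : sweep A b G (rcons o L) s = update A b G (sweep A b G o s) L.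
  by rewrite /sweep foldl_rcons.
have [ug ux] := update_good LG ep0 gd1.
rewrite sE; split.
  move=> K l lc; have [KL|KL] := eqVneq K L; last first.
    by apply: update_other => //; exact: gd1.
  rewrite KL in lc *; apply: good_mono (ug _ lc); rewrite ?mulr_gt0 //.
  by rewrite ger_pMl // ltW.
move=> K; rewrite mem_rcons inE; have [-> _|KL /= Ko] := eqVneq K L.
  by split.
have [g1 g2] := gd2 _ Ko; split.
  by move=> l lc; apply: update_other => //; exact: g1.
by move=> j jJ; rewrite /= (negPf KL); exact: g2.
Qed.

(** The messages vanish at the start, so the defect is the coupling itself; it is
    within ep times the budget once xs is at most ep * w on every block. *)
Lemma init_good : exists2 ep, 0 < ep & all_good (init_state R d) ep.
Proof.
pose ep : R := 1 + \sum_(k in F) N (subvec xs k) / w k.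
have term0 k : k \in F -> 0 <= N (subvec xs k) / w k.
  by move=> kF; rewrite divr_ge0 ?(ltW (w_gt0 kF)) ?(vnorm_ge0 (hN kF)).
have ep0 : 0 < ep by rewrite ltr_wpDr // sumr_ge0.
exists ep => // K l lc u; have lF := child_F lc; have hl := hN lF.
rewrite /= mul0mx mulmx0 (vnorm0 hl) mulr0 mulr_ge0 ?vnorm_ge0 //.
rewrite /slack subr_ge0 ler_pdivrMr // /defect /= mul0mx subrr add0r.
rewrite /coupling mulmx_sumr; apply: le_trans (vnorm_sum hl _ _ _) _.
rewrite /budget mulr_suml; apply: ler_sum => k /andP[/andP[kF _] kl].
apply: le_trans (Dinv_block_norm _ lF kF kl) _.
rewrite -mulrA ler_wpM2l ?Rnorm_ge0 // mulrC -ler_pdivrMr ?w_gt0 //.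
rewrite /ep (bigD1 k) //= addrCA lerDl addr_ge0 // sumr_ge0 // => i /andP[iF _].
exact: term0.
Qed.

Variable order : seq {set 'I_d}.
Hypothesis order_large : perm_eq order (enum (large G)).

Lemma mem_order L : (L \in order) = (L \in large G).
Proof. by rewrite (perm_mem order_large) mem_enum. Qed.

Lemma gabp_good : exists2 ep, 0 < ep & forall n,
  all_good (gabp A b G order n) (th ^+ n * ep) /\
  forall L, L \in large G ->
    xval_close (gabp A b G order n.+1) (th ^+ n.+1 * ep) L.
Proof.
have [ep ep0 gd0] := init_good; exists ep => // n.
have oG : {subset order <= large G} by move=> L; rewrite mem_order.
have pos m : 0 < th ^+ m * ep by rewrite mulr_gt0 // exprn_gt0.
have gd : all_good (gabp A b G order n) (th ^+ n * ep).
  elim: n => [|n IH]; first by rewrite expr0 mul1r.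
  have [_ g] := sweep_good (pos n) oG IH.
  move=> K l lc; rewrite exprS -mulrA.
  have /g[gK _] : K \in order.
    by rewrite mem_order; move: lc; rewrite childrenE => /(redgesP G_two_layer)[].
  exact: gK.
split => // L LG; have [_ g] := sweep_good (pos n) oG gd.
by rewrite exprS -mulrA; have /g[] : L \in order by rewrite mem_order.
Qed.

Lemma gabp_is_defined : gabp_defined A b G order.
Proof.
have [ep ep0 gd] := gabp_good => n pre L post oE.
have oG K : K \in pre ++ L :: post -> K \in large G by rewrite -oE mem_order.
have pos : 0 < th ^+ n * ep by rewrite mulr_gt0 // exprn_gt0.
have [|g _] := sweep_good (o := pre) pos _ (gd n).1.
  by move=> K Kp; apply: oG; rewrite mem_cat Kp.
by apply: (update_defined_good _ pos g); apply: oG; rewrite mem_cat mem_head orbT.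
Qed.

Lemma gabp_cvg L : L \in large G ->
  (fun n : nat => xval (gabp A b G order n) L) @ \oo --> subvec xs L.
Proof.
move=> LG; have [ep ep0 gd] := gabp_good.
have /choice[C hC] : forall k : {set 'I_d}, exists C : R, k \in F ->
    0 < C /\ forall (x : 'cV[R]_#|k|) a, `|x a 0| <= C * N x.
  move=> k; have [kF|kF] := boolP (k \in F); last by exists 0.
  by have [C C0 hC] := vnorm_coord (hN kF); exists C.
pose M : R := \sum_(k in F) C k * w k * ep.
have term0 k : k \in F -> 0 <= C k * w k * ep.
  by move=> kF; rewrite !mulr_ge0 // ltW ?w_gt0 ?(hC _ kF).1.
have M0 : 0 <= M by apply: sumr_ge0.
have bnd n : `|subvec xs L - xval (gabp A b G order n.+1) L| <= M * th ^+ n.+1.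
  have Mth : 0 <= M * th ^+ n.+1 by rewrite mulr_ge0 // exprn_ge0 // ltW.
  rewrite distrC; set e := _ - _; have := @mx_normrE _ _ _ e.
  rewrite [`|e|]/Num.norm /= => ->.
  apply/bigmax_leP; split=> // -[a c] _ /=; rewrite ord1.
  have aL := enum_valP a; set v := enum_val a in aL.
  have [k kF vk] : exists2 k, k \in F & v \in k.
    have /and3P[/eqP covF _ _] := F_partition.
    by have : v \in finset.cover F; [rewrite covF inE|case/finset.bigcupP => k; exists k].
  have kL := block_subset G_two_layer G_valid F_partition kF LG vk aL.
  have E : enum_val (enum_rank_in vk v) = enum_val a by rewrite enum_rankK_in.
  rewrite -(restr_vecE e E); apply: le_trans ((hC k kF).2 _ _) _.
  have kJ : inL L k by rewrite /inL kF.
  have := (gd n).2 L LG k kJ; rewrite -(ler_pM2l (hC k kF).1) => /le_trans; apply.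
  have -> : C k * (th ^+ n.+1 * ep * w k) = C k * w k * ep * th ^+ n.+1 by ring.
  rewrite ler_wpM2r ?exprn_ge0 ?(ltW th0) // /M (bigD1 k) //= lerDl.
  by apply: sumr_ge0 => i /andP[iF _]; exact: term0.
rewrite -cvg_shiftS; apply/cvgrPdist_lt => e e0.
have geo : (fun n => M * th ^+ n.+1) @ \oo --> 0.
  have := @cvg_geometric R M th; rewrite gtr0_norm // => /(_ th1).
  by rewrite -cvg_shiftS.
move/cvgrPdist_lt/(_ _ e0): geo; apply: filterS => n.
rewrite sub0r normrN => Mn; apply: le_lt_trans (bnd n) _.
exact: le_lt_trans (ler_norm _) Mn.
Qed.

End Convergence.

(** * Convergence *)

Theorem mainTheorem5 (R : realType) (d : nat) (A : 'M[R]_d) (b : 'cV[R]_d)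
  (G : region_graph d) (order : seq {set 'I_d})
  (A_inv : A \in unitmx)
  (G_two_layer : two_layer A G)
  (G_valid : valid A G)
  (F_partition : finset.partition (Fpart G) [set: 'I_d]%SET)
  (det_Aii : forall i, i \in Fpart G -> \det (block A i i) != 0)
  (order_large : perm_eq order (enum (large G)))
  (rho_lt1 : exists2 N : forall k : {set 'I_d}, 'cV[R]_#|k| -> R,
     forall i, i \in Fpart G -> vector_norm (N i) &
     spectral_radius (normRtilde A (Fpart G) N) < 1) :
  gabp_defined A b G order /\
  forall L, L \in large G ->
    (fun n : nat => xval (gabp A b G order n) L) @ \oo
      --> subvec (invmx A *m b) L.
Proof.
have [N hN rho] := rho_lt1.
have T0 p q : 0 <= normRtilde A (Fpart G) N p q.
  by rewrite mxE; apply: opnorm_ge0; apply: hN; exact: enum_valP.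
have [w' [th [th01 w'0 hw']]] := contraction_weights T0 rho.
(* The weights are indexed by positions in the enumeration of the partition;
   the sum below has one term, and is a way to index them by the blocks. *)
pose w (k : {set 'I_d}) : R := \sum_(p < #|Fpart G| | enum_val p == k) w' p.
have wE p : w (enum_val p) = w' p.
  by rewrite /w (big_pred1 p) // => q; rewrite (inj_eq enum_val_inj).
have w0 i : i \in Fpart G -> 0 < w i.
  by move=> iF; rewrite -(enum_rankK_in iF iF) wE.
have hw i : i \in Fpart G ->
    \sum_(k in Fpart G) Rnorm A N i k * w k <= th * w i.
  move=> iF; rewrite -(enum_rankK_in iF iF) wE; apply: le_trans (hw' _).
  rewrite big_enum_val le_eqVlt; apply/orP; left; apply/eqP.
  by apply: eq_bigr => p _; rewrite wE mxE.
split.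
  exact: (gabp_is_defined b A_inv G_two_layer G_valid F_partition det_Aii hN
    th01 w0 hw order_large).
exact: (gabp_cvg A_inv G_two_layer G_valid F_partition det_Aii hN
  th01 w0 hw order_large).
Qed.
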